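(* Let $\widehat{H}$ be a finite weakly balanced bipartite signed graph with no purely red edges, whose underlying graph $H$ is a bipartite chain graph. Then $\widehat{H}$ has a special min ordering if and only if $\widehat H$ contains none of the following three signed graphs as an induced subgraph (induced in the underlying graph, with the edge types as specified): (A) a $4$-cycle $a,b,d,c,a$ in which $ab$ and $dc$ are unicoloured and $bd$ and $ca$ are bicoloured; (B) an induced path $c,a,b,d$ in which $ca$ and $bd$ are bicoloured and $ab$ is unicoloured; (C) a graph on black vertices $a,d,e$ and white vertices $b,c,f$ whose edges are exactly $ab, ac, af, bd, df, be, ce, ef$ (i.e., $K_{3,3}$ minus the edge $cd$), where $ac, af, df$ are bicoloured and $ab, bd, be, ce, ef$ are unicoloured.
   Context: A signed graph $\widehat H$ is a graph $H$ whose edges each carry the sign $+$ (blue), $-$ (red), or both (bicoloured); an edge with exactly one sign is unicoloured. Weakly balanced: every closed walk of unicoloured edges has an even number of red edges; here $\widehat H$ has no purely red edges. Bipartite: $H$ is bipartite with parts $A,B$. A bipartite chain graph is a bipartite graph in which, within each part, the neighbourhoods of the vertices are linearly ordered by inclusion. A min ordering of a bipartite graph $H$ with parts $A,B$ is a pair of linear orders of $A$ and of $B$ such that whenever $ab, a'b'$ are edges with $a,a'\in A$, $a<a'$, $b,b'\in B$, $b'<b$, then $ab'$ is an edge. A special min ordering of $\widehat H$ is a min ordering of $H$ such that at each vertex, every neighbour joined to it by a bicoloured edge precedes every neighbour joined to it by a unicoloured edge. *)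

(* Defs.v *)
From mathcomp Require Import all_boot.

Set Implicit Arguments.
Unset Strict Implicit.
Unset Printing Implicit Defensive.

(* Blue is the sign +, red is the sign -; a bicoloured edge carries both. *)
Record sgraph (V : finType) := SGraph {
  blue : rel V;
  red : rel V;
  blue_sym : symmetric blue;
  red_sym : symmetric red }.

Section SignedGraphs.

Variables (V : finType) (H : sgraph V).
Implicit Types (x y : V) (A B S : {set V}) (p : seq V).

Definition edge : rel V := [rel x y | blue H x y || red H x y].
Definition bicoloured : rel V := [rel x y | blue H x y && red H x y].
Definition unicoloured : rel V := [rel x y | blue H x y (+) red H x y].

Definition no_purely_red : Prop := forall x y, ~~ (red H x y && ~~ blue H x y).

(* The sequence p = [:: x_0; ...; x_k] is the closed walk x_0, ..., x_k, x_0,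
   and zip p (rot 1 p) lists its edges with multiplicity. *)
Definition red_count p : nat :=
  count (fun xy => red H xy.1 xy.2) (zip p (rot 1 p)).

Definition weakly_balanced : Prop :=
  forall p, cycle unicoloured p -> ~~ odd (red_count p).

Definition bipartition A B : Prop :=
  [/\ A :|: B = setT, [disjoint A & B] &
      forall x y, edge x y -> (x \in A) && (y \in B) || (x \in B) && (y \in A)].

Definition nbhd x : {set V} := [set y | edge x y].

Definition nested_on S : Prop :=
  {in S &, forall x y, (nbhd x \subset nbhd y) || (nbhd y \subset nbhd x)}.

Definition chain_graph A B : Prop :=
  [/\ bipartition A B, nested_on A & nested_on B].

(* Strict linear order on S; the values of lt outside S are irrelevant. *)
Definition linear_order_on S (lt : rel V) : Prop :=
  [/\ {in S, irreflexive lt}, {in S & &, transitive lt} &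
      {in S &, forall x y, x != y -> lt x y || lt y x}].

Definition min_ordering A B (ltA ltB : rel V) : Prop :=
  [/\ linear_order_on A ltA, linear_order_on B ltB &
      forall a a' b b', a \in A -> a' \in A -> b \in B -> b' \in B ->
        edge a b -> edge a' b' -> ltA a a' -> ltB b' b -> edge a b'].

Definition special_min_ordering A B (ltA ltB : rel V) : Prop :=
  [/\ min_ordering A B ltA ltB,
      {in A, forall v x y, bicoloured v x -> unicoloured v y -> ltB x y} &
      {in B, forall v x y, bicoloured v x -> unicoloured v y -> ltA x y}].

Definition has_special_min_ordering A B : Prop :=
  exists ltA ltB : rel V, special_min_ordering A B ltA ltB.

End SignedGraphs.

Definition contains_induced (W V : finType) (F : sgraph W) (H : sgraph V)
    : Prop :=
  exists f : W -> V, [/\ injective f,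
    forall x y, edge H (f x) (f y) = edge F x y,
    forall x y, bicoloured H (f x) (f y) = bicoloured F x y &
    forall x y, unicoloured H (f x) (f y) = unicoloured F x y].

Definition linked n (s : seq (nat * nat)) : rel 'I_n :=
  [rel x y | ((val x, val y) \in s) || ((val y, val x) \in s)].

Lemma linked_sym n s : symmetric (@linked n s).
Proof. by move=> x y; rewrite /linked /=; exact: orbC. Qed.

(* Signed graph on {0, ..., n-1} with bicoloured edges bi and blue
   unicoloured edges uni. *)
Definition sgraph_of n (bi uni : seq (nat * nat)) : sgraph 'I_n :=
  SGraph (@linked_sym n (bi ++ uni)) (@linked_sym n bi).

Definition forbiddenA : sgraph 'I_4 :=
  let '(a, b, c, d) := (0, 1, 2, 3) in
  sgraph_of 4 [:: (b, d); (c, a)] [:: (a, b); (d, c)].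

Definition forbiddenB : sgraph 'I_4 :=
  let '(a, b, c, d) := (0, 1, 2, 3) in
  sgraph_of 4 [:: (c, a); (b, d)] [:: (a, b)].

Definition forbiddenC : sgraph 'I_6 :=
  let '(a, b, c, d, e, f) := (0, 1, 2, 3, 4, 5) in
  sgraph_of 6 [:: (a, c); (a, f); (d, f)]
              [:: (a, b); (b, d); (b, e); (c, e); (e, f)].

(* Main.v *)
Require Import Defs.
From mathcomp Require Import all_boot.
From mathcomp Require Import zify.

(** Write [bi x] for the set of bicoloured neighbours of [x], and order the
    vertices by decreasing [#|bi x|], ties being broken by decreasing degree.
    Without (A) and (B), whenever [v x] is bicoloured and [v y] unicoloured,
    [bi y] is strictly contained in [bi x], so the order is special. If
    [x] precedes [y] although the neighbourhood of [x] is strictly smaller, then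
    some [v] forces it, with [v x] bicoloured and [v y] unicoloured. A
    violation of the min ordering property consists of two such inversions,
    one in each part, around an induced path on four vertices, and the
    witnesses of the inversions complete this path to (C). Conversely, in each
    of (A), (B), (C) the order relations
    forced by the special property contradict linearity or the min ordering
    property. *)

Set Implicit Arguments.
Unset Strict Implicit.
Unset Printing Implicit Defensive.

(** * Symmetry of the adjacency relations and types of vertex pairs *)

Section EdgeTypes.

Variables (V : finType) (H : sgraph V).
Implicit Types x y : V.

Lemma edgeC x y : edge H x y = edge H y x.
Proof. by rewrite /edge /= blue_sym red_sym. Qed.

Lemma bicolouredC x y : bicoloured H x y = bicoloured H y x.
Proof. by rewrite /bicoloured /= blue_sym red_sym. Qed.

Lemma unicolouredE x y : unicoloured H x y = edge H x y && ~~ bicoloured H x y.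
Proof.
by rewrite /unicoloured /edge /bicoloured /=; case: blue; case: red.
Qed.

Lemma unicolouredC x y : unicoloured H x y = unicoloured H y x.
Proof. by rewrite !unicolouredE edgeC bicolouredC. Qed.

Lemma bicoloured_edge x y : bicoloured H x y -> edge H x y.
Proof. by rewrite /edge /bicoloured /= => /andP[->]. Qed.

Lemma unicoloured_edge x y : unicoloured H x y -> edge H x y.
Proof. by rewrite unicolouredE => /andP[]. Qed.

(** These two booleans determine [unicoloured] as well, so one equation per pair settles all three
    relations in [contains_induced]. *)
Definition edge_type x y := (edge H x y, bicoloured H x y).

Lemma edge_typeC x y : edge_type x y = edge_type y x.
Proof. by rewrite /edge_type edgeC bicolouredC. Qed.

Lemma bicoloured_type x y : bicoloured H x y -> edge_type x y = (true, true).
Proof. by move=> xy; rewrite /edge_type xy bicoloured_edge. Qed.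

Lemma unicoloured_type x y : unicoloured H x y -> edge_type x y = (true, false).
Proof.
by rewrite unicolouredE => /andP[xy /negbTE nxy]; rewrite /edge_type xy nxy.
Qed.

Lemma nonedge_type x y : edge H x y = false -> edge_type x y = (false, false).
Proof.
move=> xy; rewrite /edge_type xy; congr pair; apply/negP => /bicoloured_edge.
by rewrite xy.
Qed.

End EdgeTypes.

(* Injectivity of the embedding comes for free when no two vertices of the
   pattern have the same adjacencies. *)
Lemma contains_induced_intro n (F : sgraph 'I_n) (V : finType) (H : sgraph V)
    (f : 'I_n -> V) :
  (forall x y : 'I_n, x < y -> exists z, edge_type F x z != edge_type F y z) ->
  irreflexive (edge F) -> irreflexive (edge H) ->
  (forall x y : 'I_n, x < y -> edge_type H (f x) (f y) = edge_type F x y) ->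
  contains_induced F H.
Proof.
move=> twinfree irrF irrH typelt.
have type x y : edge_type H (f x) (f y) = edge_type F x y.
  case: (ltngtP x y) => [/typelt //|/typelt|/val_inj ->].
    by rewrite edge_typeC [RHS]edge_typeC.
  by rewrite !nonedge_type.
have nlt x y : f x = f y -> ~~ (x < y).
  by move=> fxy; apply/negP => /twinfree[z]; rewrite -!type fxy eqxx.
exists f; split=> [x y fxy|x y|x y|x y].
- have := nlt _ _ fxy; have := nlt _ _ (esym fxy).
  by rewrite -!leqNgt => xy yx; apply/val_inj/anti_leq; rewrite yx xy.
- by have [] := type x y.
- by have [] := type x y.
- by rewrite !unicolouredE; have [-> ->] := type x y.
Qed.

(** * Recognising the three patterns in a bipartite graph *)

Section Patterns.

Variables (V : finType) (H : sgraph V) (A B : {set V}).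
Hypothesis bipAB : bipartition H A B.
Implicit Types (a b c d e f x y : V).

Lemma in_bipartitionC x : (x \in B) = (x \notin A).
Proof.
case: bipAB => cover disj _; have := in_setT x; rewrite -cover in_setU.
have [xA _|_ /orP[//|->//]] := boolP (x \in A).
by rewrite (disjointFr disj xA).
Qed.

Lemma edge_side x y : edge H x y -> (y \in A) = (x \notin A).
Proof.
case: bipAB => _ _ /(_ x y) h /h; rewrite !in_bipartitionC.
by case: (x \in A); case: (y \in A).
Qed.

Lemma same_side_edgeF x y : (x \in A) = (y \in A) -> edge H x y = false.
Proof.
by move=> xy; apply/negP => /edge_side; rewrite xy; case: (y \in A).
Qed.

Lemma edge_irr : irreflexive (edge H).
Proof. by move=> x; apply: same_side_edgeF. Qed.

(** The remaining pairs [a d] and [b c] each lie within one side, hence are nonedges. *)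
Lemma forbiddenA_intro a b c d :
  unicoloured H a b -> bicoloured H b d -> unicoloured H d c ->
  bicoloured H c a -> contains_induced forbiddenA H.
Proof.
move=> ab bd dc ca.
have sb := edge_side (unicoloured_edge ab).
have sd := edge_side (bicoloured_edge bd).
have sc := edge_side (unicoloured_edge dc).
apply: (@contains_induced_intro _ _ _ _ (fun i => nth a [:: a; b; c; d] i)).
- move=> [[|[|[|[|//]]]] ?] [[|[|[|[|//]]]] ?] //= _;
  by [exists (@Ordinal 4 0 isT) | exists (@Ordinal 4 1 isT) |
      exists (@Ordinal 4 2 isT) | exists (@Ordinal 4 3 isT)].
- by move=> [[|[|[|[|//]]]] ?].
- exact: edge_irr.
- move=> [[|[|[|[|//]]]] ?] [[|[|[|[|//]]]] ?] //= _;
  by [apply: bicoloured_type | apply: unicoloured_type |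
      rewrite edge_typeC; apply: bicoloured_type |
      rewrite edge_typeC; apply: unicoloured_type |
      apply: nonedge_type; apply: same_side_edgeF;
        rewrite ?sc ?sd ?sb ?negbK].
Qed.

(** Bipartiteness excludes the chords [a d] and [b c], but [c] and [d] lie on opposite sides, so
    their nonadjacency has to be assumed. *)
Lemma forbiddenB_intro a b c d :
  bicoloured H c a -> unicoloured H a b -> bicoloured H b d ->
  edge H c d = false -> contains_induced forbiddenB H.
Proof.
move=> ca ab bd cd.
have sa := edge_side (bicoloured_edge ca).
have sb := edge_side (unicoloured_edge ab).
have sd := edge_side (bicoloured_edge bd).
apply: (@contains_induced_intro _ _ _ _ (fun i => nth a [:: a; b; c; d] i)).
- move=> [[|[|[|[|//]]]] ?] [[|[|[|[|//]]]] ?] //= _;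
  by [exists (@Ordinal 4 0 isT) | exists (@Ordinal 4 1 isT) |
      exists (@Ordinal 4 2 isT) | exists (@Ordinal 4 3 isT)].
- by move=> [[|[|[|[|//]]]] ?].
- exact: edge_irr.
- move=> [[|[|[|[|//]]]] ?] [[|[|[|[|//]]]] ?] //= _;
  by [apply: bicoloured_type | apply: unicoloured_type | apply: nonedge_type |
      rewrite edge_typeC; apply: bicoloured_type |
      apply: nonedge_type; apply: same_side_edgeF;
        rewrite ?sd ?sb ?sa ?negbK].
Qed.

Lemma forbiddenC_intro a b c d e f :
  bicoloured H a c -> bicoloured H a f -> bicoloured H d f ->
  unicoloured H a b -> unicoloured H b d -> unicoloured H b e ->
  unicoloured H c e -> unicoloured H e f -> edge H c d = false ->
  contains_induced forbiddenC H.
Proof.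
move=> ac af df ab bd be ce ef cd.
have sc := edge_side (bicoloured_edge ac).
have sf := edge_side (bicoloured_edge af).
have sb := edge_side (unicoloured_edge ab).
have sd := edge_side (unicoloured_edge bd).
have se := edge_side (unicoloured_edge be).
apply: (@contains_induced_intro _ _ _ _
          (fun i => nth a [:: a; b; c; d; e; f] i)).
- move=> [[|[|[|[|[|[|//]]]]]] ?] [[|[|[|[|[|[|//]]]]]] ?] //= _;
  by [exists (@Ordinal 6 0 isT) | exists (@Ordinal 6 1 isT) |
      exists (@Ordinal 6 2 isT) | exists (@Ordinal 6 3 isT) |
      exists (@Ordinal 6 4 isT) | exists (@Ordinal 6 5 isT)].
- by move=> [[|[|[|[|[|[|//]]]]]] ?].
- exact: edge_irr.
- move=> [[|[|[|[|[|[|//]]]]]] ?] [[|[|[|[|[|[|//]]]]]] ?] //= _;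
  by [apply: bicoloured_type | apply: unicoloured_type | apply: nonedge_type |
      apply: nonedge_type; apply: same_side_edgeF;
        rewrite ?se ?sd ?sb ?sc ?sf ?negbK].
Qed.

End Patterns.

(** * A special min ordering of a chain graph without the patterns *)

Section Sufficiency.

Variables (V : finType) (H : sgraph V) (A B : {set V}).
Hypothesis chainAB : chain_graph H A B.
Hypothesis noA : ~ contains_induced forbiddenA H.
Hypothesis noB : ~ contains_induced forbiddenB H.
Hypothesis noC : ~ contains_induced forbiddenC H.
Implicit Types (u v w x y : V).

Let bipAB : bipartition H A B. Proof. by case: chainAB. Qed.

Definition bi_nbhd x : {set V} := [set y | bicoloured H x y].

Lemma nbhd_nested x y : (x \in A) = (y \in A) ->
  (nbhd H x \subset nbhd H y) || (nbhd H y \subset nbhd H x).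
Proof.
case: chainAB => _ nestA nestB; case xA: (x \in A) => yA; first exact: nestA.
by apply: nestB; rewrite (in_bipartitionC bipAB) ?xA -?yA.
Qed.

Lemma nbhd_subE x y u : nbhd H x \subset nbhd H y -> edge H x u -> edge H y u.
Proof. by move=> /subsetP/(_ u); rewrite !inE. Qed.

(** Nestedness as it is used below: a chain graph has no two disjoint edges that induce only
    themselves. *)
Lemma crossing_edge x y u v : (x \in A) = (y \in A) ->
  edge H x u -> edge H y v -> edge H x v || edge H y u.
Proof.
move=> /nbhd_nested /orP[] /nbhd_subE sub xu yv; last by rewrite sub.
by rewrite (sub _ xu) orbT.
Qed.

(** Let [y u] be bicoloured. If [x u] is a nonedge, the path [x v y u] is (B); if it is unicoloured,
    the cycle [v y u x] is (A). *)
Lemma bi_nbhd_sub v x y :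
  bicoloured H v x -> unicoloured H v y -> bi_nbhd y \subset bi_nbhd x.
Proof.
move=> vx vy; apply/subsetP => u; rewrite !inE => yu.
case xu: (edge H x u); last first.
  by case: noB; apply: (@forbiddenB_intro _ _ _ _ bipAB v y x u);
    rewrite // bicolouredC.
case bxu: (bicoloured H x u) => //.
have uxu : unicoloured H u x by rewrite unicolouredC unicolouredE xu bxu.
case: noA; apply: (@forbiddenA_intro _ _ _ _ bipAB v y x u) => //.
by rewrite bicolouredC.
Qed.

Lemma bi_nbhd_proper v x y :
  bicoloured H v x -> unicoloured H v y -> bi_nbhd y \proper bi_nbhd x.
Proof.
move=> vx vy; apply/properP; split; first exact: bi_nbhd_sub vx vy.
(* The vertex [v] itself separates the two sets. *)
exists v; rewrite inE bicolouredC //.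
by move: vy; rewrite unicolouredE => /andP[].
Qed.

Definition bi_degree x := #|bi_nbhd x|.
Definition degree x := #|nbhd H x|.

(** Lexicographic; [enum_rank] decides between vertices that agree in both degrees, which makes the
    order total. *)
Definition bi_first : rel V := [rel x y |
  (bi_degree y < bi_degree x) || (bi_degree x == bi_degree y) &&
    ((degree y < degree x) || (degree x == degree y) &&
       (enum_rank x < enum_rank y))].

Lemma bi_first_linear (S : {set V}) : linear_order_on S bi_first.
Proof.
split=> [x _|y x z _ _ _|x y _ _ xy]; rewrite /bi_first /=; try lia.
have : enum_rank x != enum_rank y :> nat.
  by apply: contraNneq xy => /val_inj/enum_rank_inj ->.
by move: (nat_of_ord _) (nat_of_ord _) => i j; lia.
Qed.

Lemma bi_first_special v x y :
  bicoloured H v x -> unicoloured H v y -> bi_first x y.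
Proof.
move=> vx vy.
by rewrite /bi_first /= (proper_card (bi_nbhd_proper vx vy)).
Qed.

(** By nestedness [y] has the larger degree, so [x] can only come first by a strictly larger
    [bi_degree]. Some [v] is then in [bi_nbhd x] but not in [bi_nbhd y], and it is still adjacent to
    [y]. *)
Lemma inversion_forced x y u : (x \in A) = (y \in A) -> bi_first x y ->
  edge H x u = false -> edge H y u ->
  exists2 v, bicoloured H v x & unicoloured H v y.
Proof.
move=> xy lt_xy xu yu.
have sub : nbhd H x \subset nbhd H y.
  have /orP[//|/nbhd_subE/(_ yu)] := nbhd_nested xy; by rewrite xu.
have deg : degree x < degree y.
  apply: proper_card; apply/properP; split=> //; exists u; rewrite inE //.
  by rewrite xu.
have bdeg : bi_degree y < bi_degree x by move: lt_xy; rewrite /bi_first /=; lia.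
have /subsetPn[v] : ~~ (bi_nbhd x \subset bi_nbhd y).
  by apply/negP => /subset_leq_card; rewrite leqNgt bdeg.
rewrite !inE => xv yv; exists v; first by rewrite bicolouredC.
by rewrite unicolouredC unicolouredE yv (nbhd_subE sub) // bicoloured_edge.
Qed.

Lemma bi_first_min x x' y y' : (x \in A) = (x' \in A) ->
  edge H x y -> edge H x' y' -> bi_first x x' -> bi_first y' y -> edge H x y'.
Proof.
move=> side xy x'y' lt_x lt_y; apply/negPn/negP => /negbTE xy'.
have x'y : edge H x' y.
  by have := crossing_edge side xy x'y'; rewrite xy'.
have side' : (y' \in A) = (y \in A).
  by rewrite (edge_side bipAB x'y') (edge_side bipAB x'y).
(* The nonedge [x y'] makes both pairs inversions: [x] before [x'], seen from [y'], and [y'] before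
   [y], seen from [x]. *)
have [v vx vx'] := inversion_forced side lt_x xy' x'y'.
have [w wy' wy] : exists2 w, bicoloured H w y' & unicoloured H w y.
  by apply: (inversion_forced side' lt_y (u := x)); rewrite edgeC.
have subx := subsetP (bi_nbhd_sub vx vx').
have suby := subsetP (bi_nbhd_sub wy' wy).
(* All three edges of the path [x y x' y'] are unicoloured: a bicoloured end edge would, by [subx]
   or [suby], make [x y'] an edge, and a bicoloured [x' y] would make [x y] bicoloured. *)
have ux'y' : unicoloured H x' y'.
  rewrite unicolouredE x'y'; apply/negP => /=; move: (subx y').
  by rewrite !inE => h /h /bicoloured_edge; rewrite xy'.
have uxy : unicoloured H x y.
  rewrite unicolouredE xy; apply/negP => /=; move: (suby x).
  by rewrite !inE bicolouredC => h /h /bicoloured_edge; rewrite edgeC xy'.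
have ux'y : unicoloured H x' y.
  rewrite unicolouredE x'y; apply/negP => /=; move: (subx y).
  by rewrite !inE => h /h xyb; move: uxy; rewrite unicolouredE xyb andbF.
(* The edges [x v] and [w y'] must be crossed, and [x y'] is a nonedge. *)
have wv : edge H w v.
  have sidew : (x \in A) = (w \in A).
    have := edge_side bipAB xy; rewrite (edge_side bipAB (unicoloured_edge wy)).
    by move=> /negb_inj.
  have := crossing_edge sidew _ (bicoloured_edge wy') (u := v).
  by rewrite xy' edgeC bicoloured_edge //= => /(_ isT).
(* Otherwise the path [x v w y'] is (B). *)
have bvw : bicoloured H v w.
  apply/negPn/negP => nvw; case: noB.
  apply: (@forbiddenB_intro _ _ _ _ bipAB v w x y');
    by rewrite // ?unicolouredE 1?edgeC ?wv // bicolouredC.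
case: noC; apply: (@forbiddenC_intro _ _ _ _ bipAB v x' x y' y w) => //.
- by rewrite bicolouredC.
- by rewrite unicolouredC.
Qed.

Lemma bi_first_special_min_ordering :
  special_min_ordering H A B bi_first bi_first.
Proof.
split=> [|v _ x y|v _ x y]; try exact: bi_first_special.
split; try exact: bi_first_linear.
by move=> a a' b b' aA a'A _ _; apply: bi_first_min; rewrite aA a'A.
Qed.

End Sufficiency.

(** * A special min ordering excludes each pattern *)

Section Necessity.

Variables (V : finType) (H : sgraph V) (A B : {set V}) (ltA ltB : rel V).
Hypothesis bipAB : bipartition H A B.
Hypothesis special : special_min_ordering H A B ltA ltB.
Implicit Types (u v w x y : V).

(** Merging the two orders lets a pattern be treated without knowing which of its sides lies in
    [A]. *)
Definition side_lt : rel V := [rel x y | if x \in A then ltA x y else ltB x y].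

Lemma side_lt_special v x y :
  bicoloured H v x -> unicoloured H v y -> side_lt x y.
Proof.
move=> vx vy; rewrite /side_lt /= (edge_side bipAB (bicoloured_edge vx)).
case: special => _ spA spB; case vA: (v \in A) => /=; first exact: spA vx vy.
by apply: spB vx vy; rewrite (in_bipartitionC bipAB) vA.
Qed.

Lemma side_lt_asym x y : (x \in A) = (y \in A) -> side_lt x y -> ~~ side_lt y x.
Proof.
case: special => -[[irrA trA _] [irrB trB _] _] _ _.
rewrite /side_lt /= => xy; rewrite -xy; case xA: (x \in A).
  move=> lt1; apply/negP => lt2; have yA : y \in A by rewrite -xy.
  by have := trA _ _ _ yA xA xA lt1 lt2; rewrite irrA.
have xB : x \in B by rewrite (in_bipartitionC bipAB) xA.
have yB : y \in B by rewrite (in_bipartitionC bipAB) -xy xA.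
move=> lt1; apply/negP => lt2.
by have := trB _ _ _ yB xB xB lt1 lt2; rewrite irrB.
Qed.

Lemma side_lt_min x x' y y' : (x \in A) = (x' \in A) ->
  edge H x y -> edge H x' y' -> side_lt x x' -> side_lt y' y -> edge H x y'.
Proof.
case: special => -[_ _ minAB] _ _ xx' xy x'y'; rewrite /side_lt /=.
have := edge_side bipAB xy; have := edge_side bipAB x'y'.
rewrite -xx'; case xA: (x \in A) => /= yA y'A; rewrite yA => lt1 lt2.
  by apply: (minAB _ x' y) => //;
    rewrite ?(in_bipartitionC bipAB) ?yA ?y'A -?xx'.
(* For [x] in [B] the parts swap roles: [y'] and [y] are now the pair in [A]. *)
rewrite edgeC; apply: (minAB _ y x') => //; rewrite 1?edgeC //.
- by rewrite (in_bipartitionC bipAB) -xx' xA.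
- by rewrite (in_bipartitionC bipAB) xA.
Qed.

(** The vertex [a] forces [c] before [b], while [d] forces [b] before [c]. *)
Lemma special_no_forbiddenA : ~ contains_induced forbiddenA H.
Proof.
move=> [f [_ fE fB fU]].
pose o k (ltk : k < 4) := f (Ordinal ltk).
pose a := o 0 isT; pose b := o 1 isT; pose c := o 2 isT; pose d := o 3 isT.
have ab : edge H a b by rewrite fE.
have ac : edge H a c by rewrite fE.
have cb : side_lt c b by apply: (@side_lt_special a); rewrite ?fB ?fU.
have bc : side_lt b c by apply: (@side_lt_special d); rewrite ?fB ?fU.
have side : (c \in A) = (b \in A).
  by rewrite (edge_side bipAB ab) (edge_side bipAB ac).
by have := side_lt_asym side cb; rewrite bc.
Qed.

(** With [c] before [b] (seen from [a]) and [d] before [a] (seen from [b]), the edges [c a] and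
    [b d] force the missing edge [c d]. *)
Lemma special_no_forbiddenB : ~ contains_induced forbiddenB H.
Proof.
move=> [f [_ fE fB fU]].
pose o k (ltk : k < 4) := f (Ordinal ltk).
pose a := o 0 isT; pose b := o 1 isT; pose c := o 2 isT; pose d := o 3 isT.
have ab : edge H a b by rewrite fE.
have ac : edge H a c by rewrite fE.
have cb : side_lt c b by apply: (@side_lt_special a); rewrite ?fB ?fU.
have da : side_lt d a by apply: (@side_lt_special b); rewrite ?fB ?fU.
have side : (c \in A) = (b \in A).
  by rewrite (edge_side bipAB ab) (edge_side bipAB ac).
suff : edge H c d by rewrite fE.
by apply: (side_lt_min side _ _ cb da); rewrite fE.
Qed.

(** With [c] before [b] (seen from [a]) and [d] before [e] (seen from [f]), the edges [c e] and
    [b d] force the missing edge [c d]. *)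
Lemma special_no_forbiddenC : ~ contains_induced forbiddenC H.
Proof.
move=> [g [_ gE gB gU]].
pose o k (ltk : k < 6) := g (Ordinal ltk).
pose a := o 0 isT; pose b := o 1 isT; pose c := o 2 isT; pose d := o 3 isT.
pose e := o 4 isT; pose f := o 5 isT.
have ab : edge H a b by rewrite gE.
have ac : edge H a c by rewrite gE.
have cb : side_lt c b by apply: (@side_lt_special a); rewrite ?gB ?gU.
have de : side_lt d e by apply: (@side_lt_special f); rewrite ?gB ?gU.
have side : (c \in A) = (b \in A).
  by rewrite (edge_side bipAB ab) (edge_side bipAB ac).
suff : edge H c d by rewrite gE.
by apply: (side_lt_min side _ _ cb de); rewrite gE.
Qed.

End Necessity.

Theorem theorem7 (V : finType) (H : sgraph V) (A B : {set V}) :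
  bipartition H A B ->
  weakly_balanced H ->
  no_purely_red H ->
  chain_graph H A B ->
  has_special_min_ordering H A B <->
  [/\ ~ contains_induced forbiddenA H,
      ~ contains_induced forbiddenB H &
      ~ contains_induced forbiddenC H].
Proof.
move=> bipAB _ _ chainAB; split=> [[ltA [ltB special]]|[noA noB noC]].
  split; [exact: special_no_forbiddenA special |
          exact: special_no_forbiddenB special |
          exact: special_no_forbiddenC special].
by exists (bi_first H), (bi_first H); exact: bi_first_special_min_ordering.
Qed.
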